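(* Let $A=A^*$ and $B=B^*$ be two unbounded self-adjoint operators in a Hilbert space such that $AB$ is densely defined. If $A$ commutes with $B$, i.e. $AB\subset BA$, then $AB$ is a symmetric operator and $$(AB)^*\supset \overline{BA}\supset\overline{AB}\supset AB.$$ Further, then $AB$ is self-adjoint if and only if $$(AB)^*=\overline{BA}=\overline{AB}=AB.$$
   Context: ''Unbounded operator'' means a linear operator defined on a linear subspace (domain) of a Hilbert space, not necessarily bounded. $S\subset T$ (equivalently $T\supset S$) means that $T$ extends $S$. The product $AB$ has domain $D(AB)=\{x\in D(B): Bx\in D(A)\}$. ''$A$ commutes with $B$'' means $AB\subset BA$. $\overline{T}$ denotes the closure of a closeable operator $T$. A densely defined operator $T$ is symmetric if $T\subset T^*$. *)

(* Defs.v *)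
From HB Require Import structures.
From mathcomp Require Import all_boot all_order all_algebra.
From mathcomp Require Import complex.
From mathcomp Require Import all_classical all_reals.
From mathcomp Require Import topology normedtype.

Set Implicit Arguments.
Unset Strict Implicit.
Unset Printing Implicit Defensive.

Import Order.TTheory GRing.Theory Num.Theory.
Import numFieldNormedType.Exports.

Local Open Scope classical_set_scope.
Local Open Scope ring_scope.
Local Open Scope complex_scope.

(* The inner product is linear on the left and conjugate-linear on the right. *)
HB.mixin Record NormedModule_isHilbert (R : realType) (H : Type)
    of CompleteNormedModule R[i] H := {
  inner_form : {dot H for (@Num.conj R[i])} ;
  inner_form_norm : forall x : H, inner_form x x = `|x| ^+ 2
}.

#[short(type="hilbertType")]
HB.structure Definition Hilbert (R : realType) :=
  {H of NormedModule_isHilbert R H & CompleteNormedModule R[i] H}.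

Section InnerProduct.
Variables (R : realType) (H : hilbertType R).
Implicit Types (a : R[i]) (x y z : H).

Definition inner x y : R[i] := inner_form x y.

Lemma innerxx x : inner x x = `|x| ^+ 2.
Proof. exact: inner_form_norm. Qed.

Lemma innerC x y : inner x y = (inner y x)^*%R.
Proof. by rewrite /inner [LHS]hermC/= mul1r. Qed.

Lemma innerPl a x y z : inner (a *: x + y) z = a * inner x z + inner y z.
Proof. exact: (linearPl (inner_form : {dot H for _})). Qed.

Lemma innerPr a x y z :
  inner z (a *: x + y) = a^*%R * inner z x + inner z y.
Proof. by rewrite innerC innerPl rmorphD rmorphM/= -!innerC. Qed.

Lemma inner0r x : inner x 0 = 0.
Proof.
by have := innerPr (-1) 0 0 x; rewrite scaler0 addr0 rmorphN1 mulN1r addNr.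
Qed.

Lemma innerBr x y z : inner x (y - z) = inner x y - inner x z.
Proof.
by rewrite -(scaleN1r z) addrC innerPr rmorphN1 mulN1r addrC.
Qed.

Lemma innerBl x y z : inner (x - y) z = inner x z - inner y z.
Proof. by rewrite innerC innerBr rmorphB/= -!innerC. Qed.

End InnerProduct.

Notation "''[' x , y ]" := (inner x y) : ring_scope.

(* The values of [op_fun] outside [op_dom] are irrelevant: operators are to be
   compared with [op_extends] and [op_eq], not with Leibniz equality. *)
Record operator (R : realType) (H : hilbertType R) := Operator {
  op_dom : set H ;
  op_fun :> H -> H ;
  op_dom0 : op_dom 0 ;
  op_domP : forall a x y, op_dom x -> op_dom y -> op_dom (a *: x + y) ;
  op_linearP : forall a x y, op_dom x -> op_dom y ->
    op_fun (a *: x + y) = a *: op_fun x + op_fun y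
}.

Section Operators.
Variables (R : realType) (H : hilbertType R).
Implicit Types (S T A B : operator H) (a : R[i]) (x y z : H).

Definition op_extends T S :=
  op_dom S `<=` op_dom T /\ forall x, op_dom S x -> T x = S x.

Definition op_eq S T :=
  op_dom S = op_dom T /\ forall x, op_dom S x -> S x = T x.

Section Product.
Variables A B : operator H.

Definition mul_dom := [set x | op_dom B x /\ op_dom A (B x)].

Lemma mul_dom0 : mul_dom 0.
Proof.
have B0 : B 0 = 0.
  have /(_ (op_dom0 B) (op_dom0 B)) := @op_linearP _ _ B (-1) 0 0.
  by rewrite scaler0 addr0 scaleN1r addNr.
by split; [exact: op_dom0 | rewrite B0; exact: op_dom0].
Qed.

Lemma mul_domP a x y : mul_dom x -> mul_dom y -> mul_dom (a *: x + y).
Proof.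
move=> [Bx ABx] [By ABy]; split; first exact: op_domP.
by rewrite op_linearP//; exact: op_domP.
Qed.

Lemma mul_linearP a x y : mul_dom x -> mul_dom y ->
  A (B (a *: x + y)) = a *: A (B x) + A (B y).
Proof. by move=> [Bx ABx] [By ABy]; rewrite !op_linearP. Qed.

Definition op_mul : operator H :=
  @Operator R H mul_dom (fun x => A (B x)) mul_dom0 mul_domP mul_linearP.

End Product.

Definition op_commutes A B := op_extends (op_mul B A) (op_mul A B).

Definition densely_defined T := dense (op_dom T).

Definition adjoint_at T y z := forall x, op_dom T x -> '[T x, y] = '[x, z].

Lemma adjoint_at_uniq T y z z' : densely_defined T ->
  adjoint_at T y z -> adjoint_at T y z' -> z = z'.
Proof.
move=> dT Tz Tz'; apply/eqP; rewrite -subr_eq0; apply/negPn/negP => w0.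
have w_gt0 : 0 < `|z - z'| by rewrite normr_gt0.
have [||x [wx Tx]] := dT (ball (z - z') `|z - z'|).
- by exists (z - z'); exact: ballxx.
- exact: ball_open.
have xw : '[x, z - z'] = 0 by rewrite innerBr -Tz// -Tz'// subrr.
move: wx; rewrite -ball_normE /= -(ltr_pXn2r (n := 2)) ?nnegrE//.
suff -> : `|z - z' - x| ^+ 2 = `|z - z'| ^+ 2 + `|x| ^+ 2.
  by rewrite gtrDl le_gtF ?exprn_ge0.
move: (z - z') xw => w xw.
by rewrite -!innerxx innerBl !innerBr (innerC w x) xw conjC0
  subr0 sub0r opprK.
Qed.

(* [xget 0 P] is an element of [P] if there is one, and 0 otherwise; on
   [adjoint_dom T] the choice is unique by [adjoint_at_uniq]. *)
Definition adjoint_dom T := [set y | exists z, adjoint_at T y z].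
Definition adjoint_fun T y : H := xget 0 (adjoint_at T y).

Lemma adjoint_funP T y : adjoint_dom T y -> adjoint_at T y (adjoint_fun T y).
Proof. by move=> [z Tz]; rewrite /adjoint_fun; case: xgetP => // /(_ z). Qed.

Lemma adjoint_atP T a x y x' y' : adjoint_at T x x' -> adjoint_at T y y' ->
  adjoint_at T (a *: x + y) (a *: x' + y').
Proof. by move=> Tx Ty u Tu; rewrite !innerPr Tx// Ty. Qed.

Lemma adjoint_dom0 T : adjoint_dom T 0.
Proof. by exists 0 => x _; rewrite !inner0r. Qed.

Lemma adjoint_domP T a x y :
  adjoint_dom T x -> adjoint_dom T y -> adjoint_dom T (a *: x + y).
Proof.
by move=> [x' Tx] [y' Ty]; exists (a *: x' + y'); exact: adjoint_atP.
Qed.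

Lemma adjoint_linearP T (dT : densely_defined T) a x y :
  adjoint_dom T x -> adjoint_dom T y ->
  adjoint_fun T (a *: x + y) = a *: adjoint_fun T x + adjoint_fun T y.
Proof.
move=> Tx Ty; apply: (adjoint_at_uniq dT (y := a *: x + y)).
  by apply: adjoint_funP; exact: adjoint_domP.
by apply: adjoint_atP; exact: adjoint_funP.
Qed.

Definition op_adjoint T (dT : densely_defined T) : operator H :=
  @Operator R H (adjoint_dom T) (adjoint_fun T)
    (adjoint_dom0 T) (@adjoint_domP T) (adjoint_linearP dT).

Definition op_symmetric T :=
  exists dT : densely_defined T, op_extends (op_adjoint dT) T.

Definition op_self_adjoint T :=
  exists dT : densely_defined T, op_eq T (op_adjoint dT).

Definition graph T : set (H * H) := [set p | op_dom T p.1 /\ p.2 = T p.1].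

Definition closeable T :=
  forall x y y', closure (graph T) (x, y) -> closure (graph T) (x, y') -> y = y'.

Definition closure_dom T := [set x | exists y, closure (graph T) (x, y)].
Definition closure_fun T x : H := xget 0 [set y | closure (graph T) (x, y)].

Lemma closure_funP T x :
  closure_dom T x -> closure (graph T) (x, closure_fun T x).
Proof. by move=> [y Ty]; rewrite /closure_fun; case: xgetP => // /(_ y). Qed.

Lemma closure_graphP T a (p q : H * H) :
  closure (graph T) p -> closure (graph T) q -> closure (graph T) (a *: p + q).
Proof.
move=> Tp Tq V pqV.
have cvg : (fun u : (H * H) * (H * H) => a *: u.1 + u.2) @ (p, q) --> a *: p + q.
  by apply: cvgD; [apply: cvgZr; exact: cvg_fst | exact: cvg_snd].
have [[U W] /= [pU qW] UWV] := cvg _ pqV.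
have [p' [[Tp1 Tp2] Up']] := Tp _ pU; have [q' [[Tq1 Tq2] Wq']] := Tq _ qW.
exists (a *: p' + q'); split; last by apply: (UWV (p', q')).
by split => /=; [exact: op_domP | rewrite op_linearP// Tp2 Tq2].
Qed.

Lemma closure_dom0 T : closure_dom T 0.
Proof.
exists (T 0); apply: subset_closure; split => //=; exact: op_dom0.
Qed.

Lemma closure_domP T a x y :
  closure_dom T x -> closure_dom T y -> closure_dom T (a *: x + y).
Proof.
by move=> [x' Tx] [y' Ty]; exists (a *: x' + y');
  exact: (@closure_graphP T a (x, x') (y, y')).
Qed.

Lemma closure_linearP T (cT : closeable T) a x y :
  closure_dom T x -> closure_dom T y ->
  closure_fun T (a *: x + y) = a *: closure_fun T x + closure_fun T y.
Proof.
move=> Tx Ty; apply: (cT (a *: x + y)).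
  by apply: closure_funP; exact: closure_domP.
exact: (@closure_graphP T a (x, _) (y, _) (closure_funP Tx) (closure_funP Ty)).
Qed.

Definition op_closure T (cT : closeable T) : operator H :=
  @Operator R H (closure_dom T) (closure_fun T)
    (closure_dom0 T) (@closure_domP T) (closure_linearP cT).

End Operators.

(* Main.v *)
Require Import Defs.
From mathcomp Require Import all_boot all_order all_algebra.
From mathcomp Require Import complex.
From mathcomp Require Import all_classical all_reals.
From mathcomp Require Import topology normedtype.
From mathcomp Require Import ring.

(** For x in D(BA) and u in D(AB), moving the two self-adjoint factors across
    the inner product one at a time gives <ABu, x> = <Bu, Ax> = <u, BAx>; so
    BA is contained in (AB)^*, and commutation puts AB below BA:
    AB <= BA <= (AB)^*. This is the symmetry of AB.

    An adjoint is a closed operator: the relation <Tu, x> = <u, y> survives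
    limits in the pair (x, y) because the inner product is continuous
    ([closure_graph_adjoint]). Hence every operator below (AB)^* is closeable
    and its closure is still below (AB)^*, so the chain becomes
    AB <= cl(AB) <= cl(BA) <= (AB)^*.

    If AB is self-adjoint, the two ends of the chain agree and everything
    in between collapses; conversely the three equalities compose to
    AB = (AB)^*. *)

Set Implicit Arguments.
Unset Strict Implicit.
Unset Printing Implicit Defensive.

Import Order.TTheory GRing.Theory Num.Theory.
Import numFieldNormedType.Exports.

Local Open Scope classical_set_scope.
Local Open Scope ring_scope.

(** Seen as a bare ring, [R[i]] has no inferred topology; seen as a
    [numFieldType], it gets that of the norm. *)
Definition complexes (R : realType) : numFieldType := R[i].

Section InnerContinuity.
Variables (R : realType) (H : hilbertType R).
Implicit Types (x y : H).

(** In the sum of a |a y + x|^2 over the fourth roots of unity a, the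
    coefficients a^2 of <y, x> and a of the squared norms cancel, while those
    of <x, y> are all a a^* = 1. *)
Lemma polarization x y :
  '[x, y] = 4%:R^-1 * (`|1 *: y + x| ^+ 2 - `|(-1) *: y + x| ^+ 2
    + 'i * `|'i *: y + x| ^+ 2 - 'i * `|(- 'i) *: y + x| ^+ 2).
Proof.
have i2 : 'i * 'i = -1 :> R[i] by rewrite -expr2 sqrCi.
apply: (@mulfI _ (4%:R : R[i])); first by rewrite pnatr_eq0.
rewrite mulVKf ?pnatr_eq0// -!innerxx !innerPl !innerPr.
have cNi : (- 'i)^*%R = 'i :> R[i] by rewrite rmorphN /= conjCi opprK.
rewrite cNi conjCi rmorphN1 rmorph1.
by ring: i2.
Qed.

(** Polarization reduces the statement to the continuity of the norm. *)
Lemma inner_continuous y : continuous (fun x : H => '[x, y] : complexes R).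
Proof.
have sqn (a : R[i]) :
    continuous (fun x : H => `|a *: y + x| ^+ 2 : complexes R).
  have nc : continuous (fun x : H => `|a *: y + x| : complexes R).
    move=> x; apply: cvg_norm.
    by apply: cvgD; [exact: cvg_cst | exact: cvg_id].
  by move=> x; apply: cvgM; exact: nc.
move=> x; under eq_fun do rewrite polarization.
apply: cvgM; first exact: cvg_cst.
apply: cvgB; last by apply: cvgM; [exact: cvg_cst | exact: sqn].
apply: cvgD; last by apply: cvgM; [exact: cvg_cst | exact: sqn].
by apply: cvgB; exact: sqn.
Qed.

End InnerContinuity.

Section Adjoint.
Variables (R : realType) (H : hilbertType R).
Implicit Types (S T : operator H) (x y z u : H).

Lemma adjoint_funE T (dT : densely_defined T) y z :
  adjoint_at T y z -> adjoint_fun T y = z.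
Proof.
by move=> Tyz; apply: (adjoint_at_uniq dT _ Tyz); apply: adjoint_funP; exists z.
Qed.

(** The graph of the adjoint is an intersection of zero sets of the continuous
    functions (x, y) |-> <x, Tu> - <y, u>, hence closed, and it contains
    the closure of every graph that it contains. *)
Lemma closure_graph_adjoint T S x y :
  (forall z, op_dom S z -> adjoint_at T z (S z)) ->
  closure (graph S) (x, y) -> adjoint_at T x y.
Proof.
move=> ST Sxy u Tu.
(* Conjugating puts the varying vectors on the left. *)
suff xy : '[x, T u] - '[y, u] = 0.
  by rewrite innerC [RHS]innerC; congr (_^*%R); apply/eqP; rewrite -subr_eq0 xy.
pose f (p : H * H) : complexes R := '[p.1, T u] - '[p.2, u].
have cf : continuous f.
  move=> p; apply: cvgB.
    apply: (@cvg_comp _ _ _ (@fst H H) (fun z : H => '[z, T u] : complexes R)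
      _ (nbhs p.1)); [exact: cvg_fst | exact: inner_continuous].
  apply: (@cvg_comp _ _ _ (@snd H H) (fun z : H => '[z, u] : complexes R)
    _ (nbhs p.2)); [exact: cvg_snd | exact: inner_continuous].
have cl : closed (f @^-1` [set 0]).
  move/continuous_closedP : cf; apply.
  apply: accessible_closed_set1; apply: hausdorff_accessible.
  exact: norm_hausdorff.
apply: (cl (x, y)); apply: closureS Sxy => -[z w] [/= Sz ->].
by rewrite /f /= innerC (ST z Sz u Tu) -innerC subrr.
Qed.

Lemma sub_adjoint_closeable T S : densely_defined T ->
  (forall z, op_dom S z -> adjoint_at T z (S z)) -> closeable S.
Proof.
move=> dT ST x y y' Sy Sy'.
by apply: (adjoint_at_uniq dT); apply: closure_graph_adjoint; eassumption.
Qed.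

Lemma op_extends_adjoint T (dT : densely_defined T) S :
  (forall z, op_dom S z -> adjoint_at T z (S z)) -> op_extends (op_adjoint dT) S.
Proof.
move=> ST; split=> [z Sz|z Sz]; first by exists (S z); exact: ST.
by apply: adjoint_funE => //; exact: ST.
Qed.

Lemma op_extends_adjoint_closure T (dT : densely_defined T) S
    (cS : closeable S) :
  (forall z, op_dom S z -> adjoint_at T z (S z)) ->
  op_extends (op_adjoint dT) (op_closure cS).
Proof.
move=> ST; apply: op_extends_adjoint => z Sz.
by apply: (closure_graph_adjoint ST); exact: closure_funP.
Qed.

Lemma op_extends_closure S (cS : closeable S) : op_extends (op_closure cS) S.
Proof.
have Sz z : op_dom S z -> closure (graph S) (z, S z).
  by move=> Sz; apply: subset_closure.
split=> z /Sz clz; first by exists (S z).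
by apply: (cS z _ _ _ clz); apply: closure_funP; exists (S z).
Qed.

Lemma graph_extends S T : op_extends T S -> graph S `<=` graph T.
Proof. by move=> [ST e] [z w] [/= Sz ->]; split=> /=; [exact: ST | rewrite e]. Qed.

Lemma op_closure_extends S T (cS : closeable S) (cT : closeable T) :
  op_extends T S -> op_extends (op_closure cT) (op_closure cS).
Proof.
move=> /graph_extends/closureS ST; split=> z Sz.
  by exists (closure_fun S z); apply: ST; exact: closure_funP.
have STz := ST _ (closure_funP Sz).
by apply: (cT z _ _ _ STz); apply: closure_funP; exists (closure_fun S z).
Qed.

Lemma op_extends_trans S T U :
  op_extends T S -> op_extends U T -> op_extends U S.
Proof.
move=> [ST eST] [TU eTU]; split=> x Sx; first exact/TU/ST.
by rewrite eTU ?eST//; exact: ST.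
Qed.

Lemma op_extends_anti S T : op_extends S T -> op_extends T S -> op_eq S T.
Proof.
by move=> [TS _] [ST e]; split=> [|x Sx]; [exact/seteqP | rewrite e].
Qed.

Lemma op_eq_extends S T : op_eq S T -> op_extends S T.
Proof. by move=> [e1 e2]; split=> x; rewrite -e1// => /e2. Qed.

Lemma op_eq_sym S T : op_eq S T -> op_eq T S.
Proof. by move=> [e1 e2]; split=> // x; rewrite -e1 => /e2. Qed.

Lemma op_eq_trans S T U : op_eq S T -> op_eq T U -> op_eq S U.
Proof.
move=> [e1 f1] [e2 f2]; split=> [|x Sx]; first by rewrite e1.
by rewrite f1// f2// -e1.
Qed.

Lemma self_adjoint_inner T x y : op_self_adjoint T ->
  op_dom T x -> op_dom T y -> '[T x, y] = '[x, T y].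
Proof.
move=> [dT [eD eF]] Tx Ty; rewrite (eF y Ty) /=.
by apply: adjoint_funP => //; rewrite eD in Ty.
Qed.

(** The two conditions in D(BA) license the two transpositions: x in D(A) lets
    A cross the inner product, then Ax in D(B) lets B cross it. *)
Lemma mul_adjoint_at A B : op_self_adjoint A -> op_self_adjoint B ->
  forall x, op_dom (op_mul B A) x ->
  adjoint_at (op_mul A B) x (op_mul B A x).
Proof.
move=> sA sB x [Ax BAx] u [Bu ABu] /=.
by rewrite self_adjoint_inner// self_adjoint_inner.
Qed.

End Adjoint.

Theorem theorem3 (R : realType) (H : hilbertType R) (A B : operator H)
    (sA : op_self_adjoint A) (sB : op_self_adjoint B)
    (dAB : densely_defined (op_mul A B)) (cAB : op_commutes A B) :
  op_symmetric (op_mul A B) /\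
  exists (clAB : closeable (op_mul A B)) (clBA : closeable (op_mul B A)),
    [/\ op_extends (op_adjoint dAB) (op_closure clBA),
        op_extends (op_closure clBA) (op_closure clAB)
      & op_extends (op_closure clAB) (op_mul A B)] /\
    (op_self_adjoint (op_mul A B) <->
      [/\ op_eq (op_adjoint dAB) (op_closure clBA),
          op_eq (op_closure clBA) (op_closure clAB)
        & op_eq (op_closure clAB) (op_mul A B)]).
Proof.
have BAadj := mul_adjoint_at sA sB.
have ABadj x : op_dom (op_mul A B) x ->
    adjoint_at (op_mul A B) x (op_mul A B x).
  by case: cAB => sub e ABx; rewrite -e//; exact/BAadj/sub.
split; first by exists dAB; exact: op_extends_adjoint.
have clAB := sub_adjoint_closeable dAB ABadj.
have clBA := sub_adjoint_closeable dAB BAadj.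
exists clAB, clBA.
have h1 := op_extends_adjoint_closure dAB clBA BAadj.
have h2 := op_closure_extends clAB clBA cAB.
have h3 := op_extends_closure clAB.
split=> //; split=> [[dAB' AB_adj]|[e1 e2 e3]].
  have AB_ext : op_extends (op_mul A B) (op_adjoint dAB).
    exact: op_eq_extends AB_adj.
  split; apply: op_extends_anti => //.
  - exact: op_extends_trans AB_ext (op_extends_trans h3 h2).
  - exact: op_extends_trans h1 (op_extends_trans AB_ext h3).
  - exact: op_extends_trans h2 (op_extends_trans h1 AB_ext).
by exists dAB; apply: op_eq_sym; exact: op_eq_trans e1 (op_eq_trans e2 e3).
Qed.
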